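(* Let $d\ge 2$ and $t\ge 1$ be integers and let $\{|k,m,\lambda\rangle\}$ be a Schur basis of $(\mathbb C^d)^{\otimes t}$ as described in the context, with associated operators $\hat\Pi_k^{\lambda_1\lambda_2}$, $\hat\Pi_k$, dimensions $D^k_L$, $D^k_V$, $D^k=D^k_LD^k_V$ and maps $\mathcal T_{\mathrm U}^{(k)}$. Let $d\mu(A)$ be an arbitrary normalised (probability) measure on $\mathbb A$, and let $\mathcal T_{\mathrm{SL}}$ be the collective SLOCC twirling map $$\mathcal T_{\mathrm{SL}}(\rho)=\int \big(KA_{\mathrm n}K'\big)^{\otimes t}\rho\,\big(KA_{\mathrm n}K'\big)^{\dagger\otimes t}\,d\mu(K)\,d\mu(A)\,d\mu(K'),$$ where $K,K'\in\mathrm{SU}(d)$ are integrated against the normalised Haar measure $d\mu$ on $\mathrm{SU}(d)$, $A\in\mathbb A$ and $A_{\mathrm n}=A/\|A\|$. Then for every density operator $\rho$ on $(\mathbb C^d)^{\otimes t}$: $$\mathcal T_{\mathrm{SL}}(\rho)=\sum_k\left(\frac{\beta_k}{D^k}\right)\mathcal T_{\mathrm U}^{(k)}(\rho),\qquad \beta_k=\operatorname{Tr}\!\left(\left[\int\big(A_{\mathrm n}^{\otimes t}\big)^2d\mu(A)\right]\hat\Pi_k^\dagger\right).$$ Moreover, the average success probability $\langle p_M(\rho)\rangle:=\operatorname{Tr}(\mathcal T_{\mathrm{SL}}(\rho))$ equals $\sum_k\left(\frac{\beta_k}{D^k}\right)\operatorname{Tr}\left(\rho\hat\Pi_k^\dagger\right)$,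 and for every positive integer $m$ the $m$-fold composition $\mathcal T_{\mathrm{SL}}^m=\mathcal T_{\mathrm{SL}}\circ\cdots\circ\mathcal T_{\mathrm{SL}}$ satisfies $$\mathcal T_{\mathrm{SL}}^m(\rho)=\sum_k\left(\frac{\beta_k}{D^k}\right)^m\mathcal T_{\mathrm U}^{(k)}(\rho).$$
   Context: For a permutation $p$ of $\{1,\dots,t\}$, $O_p$ denotes the (real orthogonal) operator on $(\mathbb C^d)^{\otimes t}$ permuting tensor factors: $O_p(|v_1\rangle\otimes\cdots\otimes|v_t\rangle)=|v_{p^{-1}(1)}\rangle\otimes\cdots\otimes|v_{p^{-1}(t)}\rangle$. A Schur basis is an orthonormal basis $\{|k,m,\lambda\rangle\}$ of $(\mathbb C^d)^{\otimes t}$, where $k$ runs over Young diagrams with $t$ boxes and at most $d$ rows, $m=1,\dots,D^k_L$, $\lambda=1,\dots,D^k_V$, such that under the identification $|k,m,\lambda\rangle\leftrightarrow |m\rangle\otimes|\lambda\rangle\in\mathbb C^{D^k_L}\otimes\mathbb C^{D^k_V}$ (Schur–Weyl decomposition $(\mathbb C^d)^{\otimes t}\cong\bigoplus_k\mathbb C^{D^k_L}\otimes\mathbb C^{D^k_V}$), every $X^{\otimes t}$ with $X\in\mathrm{GL}(d,\mathbb C)$ acts as $\bigoplus_k\pi_k(X)\otimes I$ and every $O_p$ acts as $\bigoplus_k I\otimes\sigma_k(p)$, where the $\pi_k$ are pairwise inequivalent irreducible representations (irreducible also when restricted to $\mathrm U(d)$) and the $\sigma_k$ are pairwise inequivalent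 irreducible representations of the symmetric group $S_t$. Define $\hat\Pi_k^{\lambda_1\lambda_2}=\sum_{m=1}^{D^k_L}|k,m,\lambda_1\rangle\langle k,m,\lambda_2|$, $\hat\Pi_k=\sum_{m,\lambda}|k,m,\lambda\rangle\langle k,m,\lambda|$ (orthogonal projector onto the $k$-th isotypic subspace), $D^k=D^k_LD^k_V$, and $$\mathcal T_{\mathrm U}^{(k)}(\rho)=\frac{1}{D^k_L}\sum_{\lambda_1,\lambda_2=1}^{D^k_V}\operatorname{Tr}\left(\rho\,\hat\Pi_k^{\lambda_1\lambda_2\dagger}\right)\hat\Pi_k^{\lambda_1\lambda_2}.$$ $\mathbb A$ denotes the group of diagonal $d\times d$ matrices with positive real diagonal entries and determinant $1$, so that every $M\in\mathrm{SL}(d,\mathbb C)$ can be written $M=KAK'$ with $K,K'\in\mathrm{SU}(d)$, $A\in\mathbb A$ (Cartan/singular value decomposition). $\|\cdot\|$ is the operator norm (largest singular value). *)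

(* Defs.v *)
(* Complex numbers are R[i] for R : realType. *)
From HB Require Import structures.
From mathcomp Require Import all_boot all_order all_algebra all_fingroup.
From mathcomp Require Import all_classical all_reals all_analysis.
From mathcomp Require Import complex.
Set Implicit Arguments. Unset Strict Implicit. Unset Printing Implicit Defensive.
Import Order.TTheory GRing.Theory Num.Theory.
Local Open Scope classical_set_scope.
Local Open Scope ring_scope.
Local Open Scope sesquilinear_scope.

Section Defs.
Variable R : realType.
Local Notation C := R[i].

(* ---------- the Hilbert space (C^d)^{\otimes t} ---------- *)
(* Computational basis of (C^d)^{\otimes t}: multi-indices s : 'I_t -> 'I_d,
   |v_1> (x) ... (x) |v_t> has coordinates \prod_s v_s (i s).  Operators are
   square matrices indexed by 'I_(dimH d t), decoded by enum_val. *)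
Definition mindex (d t : nat) := {ffun 'I_t -> 'I_d}.
Definition dimH (d t : nat) : nat := #|{: mindex d t}|.

(* X^{\otimes t} *)
Definition tpow (d t : nat) (X : 'M[C]_d) : 'M[C]_(dimH d t) :=
  \matrix_(i, j) \prod_(s < t)
     X ((enum_val i : mindex d t) s) ((enum_val j : mindex d t) s).

(* O_p (|v_1> (x) ... (x) |v_t>) = |v_{p^-1(1)}> (x) ... (x) |v_{p^-1(t)}> *)
Definition permop (d t : nat) (p : 'S_t) : 'M[C]_(dimH d t) :=
  \matrix_(i, j) ((enum_val i : mindex d t)
                   == [ffun s => (enum_val j : mindex d t) ((p^-1)%g s)])%:R.

(* inner product <u|v> *)
Definition inner n (u v : 'cV[C]_n) : C := (u ^t* *m v) 0 0.

(* ---------- representations ---------- *)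
(* rho is irreducible on the set P of group elements: nonzero dimension and
   every P-invariant subspace (row space of U, acted on by rho g) is 0 or all *)
Definition mx_irr_on (G : Type) (P : set G) n (rho : G -> 'M[C]_n) : Prop :=
  (0 < n)%N /\
  forall U : 'M[C]_n, (forall g, P g -> (U *m (rho g)^T <= U)%MS) ->
    U = 0 \/ row_full U.

(* rho1 and rho2 are equivalent on P: same dimension and an invertible
   intertwiner *)
Definition mx_equiv_on (G : Type) (P : set G) n1 n2
  (rho1 : G -> 'M[C]_n1) (rho2 : G -> 'M[C]_n2) : Prop :=
  n1 = n2 /\ exists T : 'M[C]_(n1, n2),
    \rank T = n1 /\ forall g, P g -> rho1 g *m T = T *m rho2 g.

Definition GLset d : set 'M[C]_d := [set X | X \in unitmx].
Definition Uset d : set 'M[C]_d := [set X | X *m X ^t* = 1%:M].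
Definition SUset d : set 'M[C]_d := [set X | X *m X ^t* = 1%:M /\ \det X = 1].
(* the group \mathbb A: positive diagonal, determinant 1 *)
Definition Aset d : set 'M[C]_d :=
  [set X | [/\ is_diag_mx X, forall i, 0 < X i i & \det X = 1]].

(* ---------- Young diagrams with t boxes and at most d rows ---------- *)
(* row lengths f 0 >= f 1 >= ... >= f (d-1) >= 0 summing to t *)
Definition young_pred (d t : nat) (f : {ffun 'I_d -> 'I_t.+1}) : bool :=
  [forall i : 'I_d, forall j : 'I_d, (i <= j)%N ==> (f j <= f i)%N]
  && (\sum_(i < d) (f i : nat) == t)%N.
Definition YD (d t : nat) := {f : {ffun 'I_d -> 'I_t.+1} | young_pred f}.

(* ---------- Schur basis ---------- *)
(* vec k m l = |k,m,l>;  pi k = pi_k,  sigma k = sigma_k *)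
Definition is_schur_basis (d t : nat) (DL DV : YD d t -> nat)
  (vec : forall k, 'I_(DL k) -> 'I_(DV k) -> 'cV[C]_(dimH d t))
  (pi : forall k, 'M[C]_d -> 'M[C]_(DL k))
  (sigma : forall k, 'S_t -> 'M[C]_(DV k)) : Prop :=
  (* orthonormality *)
      (forall k k' m m' l l',
         inner (vec k m l) (vec k' m' l')
         = ((k == k') && (m == m' :> nat) && (l == l' :> nat))%:R) /\
      (* completeness (a basis) *)
      (\sum_(k : YD d t) (DL k * DV k) = dimH d t)%N /\
      (* X^{\otimes t} acts as \oplus_k pi_k(X) (x) I *)
      (forall X, X \in unitmx -> forall k m l,
         tpow t X *m vec k m l = \sum_(m' < DL k) (pi k X m' m) *: vec k m' l) /\
      (* O_p acts as \oplus_k I (x) sigma_k(p) *)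
      (forall p k m l,
         permop d p *m vec k m l = \sum_(l' < DV k) (sigma k p l' l) *: vec k m l') /\
      (* pi_k irreducible on GL(d), also on U(d); pairwise inequivalent *)
      (forall k, mx_irr_on (@GLset d) (pi k) /\ mx_irr_on (@Uset d) (pi k)) /\
      (forall k k', k != k' -> ~ mx_equiv_on (@GLset d) (pi k) (pi k')) /\
      (* sigma_k irreducible representations of S_t, pairwise inequivalent *)
      (forall k, mx_irr_on setT (sigma k)) /\
      (forall k k', k != k' -> ~ mx_equiv_on setT (sigma k) (sigma k')).

(* hat Pi_k^{l1 l2} *)
Definition PiKL d t (DL DV : YD d t -> nat)
  (vec : forall k, 'I_(DL k) -> 'I_(DV k) -> 'cV[C]_(dimH d t))
  (k : YD d t) (l1 l2 : 'I_(DV k)) : 'M[C]_(dimH d t) :=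
  \sum_(m < DL k) vec k m l1 *m (vec k m l2) ^t*.

(* hat Pi_k *)
Definition PiK d t (DL DV : YD d t -> nat)
  (vec : forall k, 'I_(DL k) -> 'I_(DV k) -> 'cV[C]_(dimH d t))
  (k : YD d t) : 'M[C]_(dimH d t) :=
  \sum_(m < DL k) \sum_(l < DV k) vec k m l *m (vec k m l) ^t*.

(* T_U^{(k)} *)
Definition TU d t (DL DV : YD d t -> nat)
  (vec : forall k, 'I_(DL k) -> 'I_(DV k) -> 'cV[C]_(dimH d t))
  (k : YD d t) (rho : 'M[C]_(dimH d t)) : 'M[C]_(dimH d t) :=
  (DL k)%:R^-1 *: \sum_(l1 < DV k) \sum_(l2 < DV k)
     \tr (rho *m (PiKL vec l1 l2) ^t*) *: PiKL vec l1 l2.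

(* density operator *)
Definition density n (rho : 'M[C]_n) : Prop :=
  [/\ rho ^t* = rho, forall v : 'cV[C]_n, 0 <= (v ^t* *m rho *m v) 0 0
    & \tr rho = 1].

(* ---------- operator norm ---------- *)
Definition vnorm n (v : 'cV[C]_n) : R :=
  Num.sqrt (\sum_(i < n) (complex.Re (v i 0) ^+ 2 + complex.Im (v i 0) ^+ 2)).
(* largest singular value = sup of |Xv| over unit vectors v *)
Definition opnorm d (X : 'M[C]_d) : R :=
  sup [set vnorm (X *m v) | v in [set v : 'cV[C]_d | vnorm v = 1]].
(* A_n = A / ||A|| *)
Definition nrmz d (X : 'M[C]_d) : 'M[C]_d := (Complex (opnorm X)^-1 0) *: X.

(* ---------- measure theory on d x d complex matrices ---------- *)
(* Borel sigma-algebra: generated by the real and imaginary parts of entries *)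
Definition cmx d := 'M[C]_d.
End Defs.
HB.instance Definition _ (R : realType) d := Choice.on (cmx R d).
HB.instance Definition _ (R : realType) d := isPointed.Build (cmx R d) (0 : 'M[R[i]]_d).
Section Defs1b.
Variable R : realType.
Local Notation C := R[i].
Definition entry_gen d : set (set (cmx R d)) :=
  [set S | exists (i j : 'I_d) (B : set R), measurable B /\
     (S = (fun X : cmx R d => complex.Re (X i j)) @^-1` B \/
      S = (fun X : cmx R d => complex.Im (X i j)) @^-1` B)].
End Defs1b.

Notation MatT R d := (g_sigma_algebraType (@entry_gen R d)).

Section Defs2.
Variable R : realType.
Local Notation C := R[i].

(* entrywise integral of a complex-matrix-valued function *)
Definition cint d (mu : measure (MatT R d) R) m n (F : MatT R d -> 'M[C]_(m, n))
  : 'M[C]_(m, n) :=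
  \matrix_(i, j) Complex (Rintegral mu setT (fun x => complex.Re (F x i j)))
                         (Rintegral mu setT (fun x => complex.Im (F x i j))).

(* mu is concentrated on S *)
Definition concentrated d (mu : measure (MatT R d) R) (S : set 'M[C]_d) : Prop :=
  exists2 B : set (MatT R d), measurable B & B `<=` S /\ mu B = 1%E.

(* normalised Haar measure on SU(d): a probability measure concentrated on
   SU(d) which is left and right invariant under SU(d) *)
Definition is_haar d (mu : probability (MatT R d) R) : Prop :=
  concentrated mu (@SUset R d) /\
  forall U : 'M[C]_d, @SUset R d U -> forall S : set (MatT R d), measurable S ->
    mu ((fun X : MatT R d => (U *m X : MatT R d)) @^-1` S) = mu S /\
    mu ((fun X : MatT R d => (X *m U : MatT R d)) @^-1` S) = mu S.

(* collective SLOCC twirl *)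
Definition TSL d t (muK nu : measure (MatT R d) R) (rho : 'M[C]_(dimH d t))
  : 'M[C]_(dimH d t) :=
  cint muK (fun K => cint nu (fun A => cint muK (fun K' =>
    let M := K *m nrmz A *m K' in
    tpow t M *m rho *m tpow t (M ^t*)))).

(* beta_k *)
Definition beta d t (nu : measure (MatT R d) R) (DL DV : YD d t -> nat)
  (vec : forall k, 'I_(DL k) -> 'I_(DV k) -> 'cV[C]_(dimH d t)) (k : YD d t) : C :=
  \tr (cint nu (fun A => tpow t (nrmz A) *m tpow t (nrmz A)) *m (PiK vec k) ^t*).

End Defs2.

(* Main.v *)
(** The twirl factors as G o N o G, where G is the Haar twirl over SU(d) and
    N(X) is the average of A_n^{(x)t} X A_n^{(x)t}.  By invariance of the Haar
    measure, G(X) commutes with U^{(x)t} for U in SU(d), and by the unitary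
    trick with M^{(x)t} for every M in GL(d).  Schur's lemma then gives
    G(X) = sum_k T_U^(k)(X).  Since A_n^{(x)t} is Hermitian and commutes with
    every G(X), N multiplies G(X) by B = int (A_n^{(x)t})^2 inside a trace, and
    Tr(B Pi_k^{l l'}) = delta_{l l'} beta_k / D_V^k, so T_SL acts on the k-th
    summand as the scalar beta_k / D^k. *)
Require Import Defs.
From HB Require Import structures.
From mathcomp Require Import all_boot all_order all_algebra all_fingroup.
From mathcomp Require Import cyclic separable cyclotomic.
From mathcomp Require Import all_classical all_reals all_analysis.
From mathcomp Require Import measurable_realfun complex.
Import Order.TTheory GRing.Theory Num.Theory.
Local Open Scope classical_set_scope.
Local Open Scope ring_scope.
Local Open Scope sesquilinear_scope.
Set Implicit Arguments.
Unset Strict Implicit.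
Unset Printing Implicit Defensive.

(** Haar invariance yields commutation with SU(d) only, whereas the inequivalence of the [pi k] is a
    statement over GL(d), and A_n is invertible but in general not unitary. The unitary trick closes
    both gaps at once. The measures live on all d x d matrices, where entries are unbounded and the
    operator norm is a supremum with no evident measurability. Each has mass one on a measurable set
    [B] inside SU(d), respectively inside the positive diagonal matrices of determinant 1; on [B]
    the entries of K and A_n are bounded by 1 and the norm of A is its largest diagonal entry.
    Linearity of the integral is therefore established on [B]. The formula for the iterates rests on
    the maps T_U^(k) being pairwise orthogonal idempotents. *)

(** * Square matrices and roots of unity *)

Lemma mulmx1C_eq (F : comUnitRingType) m n (A : 'M[F]_(m, n)) (B : 'M[F]_(n, m)) :
  m = n -> A *m B = 1%:M -> B *m A = 1%:M.
Proof. by move=> e; subst n; apply: mulmx1C. Qed.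

(** In characteristic zero X^n - 1 is separable, so it has n distinct roots, and n distinct n-th
    roots of unity include a primitive one. *)
Lemma prim_root_exists (F : numClosedFieldType) n :
  (0 < n)%N -> exists z : F, n.-primitive_root z.
Proof.
move=> n_gt0; pose p : {poly F} := 'X^n - 1.
have [r] := closed_field_poly_normal p.
rewrite (monicP _) ?monicXnsubC // scale1r => Dp.
have rn1 : all n.-unity_root r by apply/allP=> z; rewrite -root_prod_XsubC -Dp.
have sz_r : (n < (size r).+1)%N.
  by rewrite -(size_prod_XsubC r id) -Dp size_XnsubC.
have [|z _ zP] := hasP (has_prim_root n_gt0 rn1 _ sz_r); last by exists z.
by rewrite -separable_prod_XsubC -Dp separable_Xn_sub_1 // pnatr_eq0 -lt0n.
Qed.

Lemma norm_root1 (F : numDomainType) (z : F) n :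
  (0 < n)%N -> `|z ^+ n| = 1 -> `|z| = 1.
Proof.
by move=> n_gt0; rewrite normrX => /eqP; rewrite pexpr_eq1 // => /eqP.
Qed.

(** * Adjoints and the singular value decomposition *)

Section Adjoint.
Variable F : numClosedFieldType.

Lemma adjE m n (A : 'M[F]_(m, n)) i j : A ^t* i j = (A j i)^*.
Proof. by rewrite !mxE. Qed.

Lemma adj_inj m n (A B : 'M[F]_(m, n)) : A ^t* = B ^t* -> A = B.
Proof. by move=> AB; rewrite -(trmxCK A) AB trmxCK. Qed.

Lemma adjM m n p (A : 'M[F]_(m, n)) (B : 'M[F]_(n, p)) :
  (A *m B) ^t* = B ^t* *m A ^t*.
Proof. by rewrite trmx_mul map_mxM. Qed.

Lemma adj_sum m n (I : finType) (E : I -> 'M[F]_(m, n)) :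
  (\sum_i E i) ^t* = \sum_i (E i) ^t*.
Proof. by rewrite !raddf_sum. Qed.

Lemma adjZ m n a (A : 'M[F]_(m, n)) : (a *: A) ^t* = a^* *: A ^t*.
Proof. by apply/matrixP => i j; rewrite !mxE rmorphM. Qed.

(* Singular values come from the spectral theorem applied to M^* M. *)
Lemma unitmx_svd n (M : 'M[F]_n) : M \in unitmx ->
  exists Q S (e : 'rV[F]_n), [/\ Q \is unitarymx, S \is unitarymx,
    forall i, e 0 i != 0 & M = Q *m diag_mx e *m S].
Proof.
move=> Mu; pose H := M ^t* *m M.
have Hn : H \is normalmx.
  by apply/normalmxP; rewrite /H adjM trmxCK.
pose S := spectralmx H; pose D := spectral_diag H.
have Su : S \is unitarymx := spectral_unitarymx H.
have SS : S *m S ^t* = 1%:M by apply/unitarymxP.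
have SS' : S ^t* *m S = 1%:M by apply: mulmx1C.
have HE : H = S ^t* *m diag_mx D *m S.
  by rewrite {1}(orthomx_spectralP Hn) invmx_unitary.
(* The columns of [N] are the images under [M] of an orthonormal eigenbasis of [H]. They are
   orthogonal with squared lengths [D], so dividing them by the singular values [e] yields the
   unitary factor Q. *)
pose N := M *m S ^t*.
have NN : N ^t* *m N = diag_mx D.
  rewrite /N adjM trmxCK !mulmxA -(mulmxA S) -/H HE !mulmxA SS mul1mx.
  by rewrite -mulmxA SS mulmx1.
have Nu : N \in unitmx.
  by rewrite unitmx_mul Mu -invmx_unitary // unitmx_inv unitarymx_unit.
have D_ge0 i : 0 <= D 0 i.
  have := congr1 (fun X : 'M[F]_n => X i i) NN.
  rewrite /diag_mx !mxE eqxx mulr1n => <-; apply: sumr_ge0 => j _.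
  by rewrite !mxE mulrC mul_conjC_ge0.
have detD : \det (diag_mx D) != 0.
  rewrite -NN det_mulmx mulf_neq0 //; last by rewrite -unitfE -unitmxE.
  by rewrite det_map_mx det_tr conjC_eq0 -unitfE -unitmxE.
have D_neq0 i : D 0 i != 0.
  move: detD; rewrite det_diag; apply: contraNneq => Di.
  by rewrite (bigD1 i) //= Di mul0r.
pose e := map_mx sqrtC D; pose f := map_mx (fun x => x^-1) e.
have e0 i : e 0 i != 0 by rewrite !mxE sqrtC_eq0.
have fe : diag_mx f *m diag_mx e = 1%:M.
  apply/matrixP => i j; rewrite mul_mx_diag !mxE.
  by case: eqVneq => [->|]; rewrite ?mulr1n ?mulr0n ?mul0r // mulVf // sqrtC_eq0.
have fa : (diag_mx f) ^t* = diag_mx f.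
  apply/matrixP => i j; rewrite !mxE eq_sym; case: eqVneq => [->|] /=;
    rewrite ?mulr1n ?mulr0n ?rmorph0 //.
  by rewrite geC0_conj // invr_ge0 sqrtC_ge0.
exists (N *m diag_mx f), S, e; split => //.
  apply/unitarymxP; apply: mulmx1C.
  rewrite adjM fa mulmxA -(mulmxA _ _ N) NN.
  apply/matrixP => i j; rewrite mul_mx_diag mul_diag_mx !mxE.
  case: eqVneq => [->|] /=; rewrite ?mulr1n ?mulr0n ?mulr0 ?mul0r //.
  by rewrite -{2}(sqrtCK (D 0 j)) expr2 mulrA mulVf ?sqrtC_eq0 // mul1r mulfV // sqrtC_eq0.
by rewrite -(mulmxA N) fe mulmx1 -mulmxA SS' mulmx1.
Qed.

End Adjoint.

(** * Schur's lemma *)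

Section SchurLemma.
Variables (R : realType) (G : Type) (P : set G).

(** The image of [T] is invariant under [rho1] and its kernel under [rho2]. As [mx_irr_on] lets the
    transposes act on row vectors, these are the row space and the left kernel of [T^T]. The second
    alternative is phrased by ranks so that it yields both n1 = n2 and the invertibility asked for
    in [mx_equiv_on]. *)
Lemma intertwiner_rank n1 n2 (rho1 : G -> 'M[R[i]]_n1) (rho2 : G -> 'M[R[i]]_n2)
    (T : 'M[R[i]]_(n1, n2)) :
  mx_irr_on P rho1 -> mx_irr_on P rho2 ->
  (forall g, P g -> rho1 g *m T = T *m rho2 g) ->
  T = 0 \/ (\rank T = n1 /\ \rank T = n2).
Proof.
move=> [_ irr1] [_ irr2] TP.
have [|im0|imT] := irr1 <<T^T>>%MS.
  move=> g Pg; rewrite genmxE (eqmxMr _ (genmxE _)) -trmx_mul TP // trmx_mul.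
  exact: submxMl.
- by left; apply/eqP; rewrite -mxrank_eq0 -mxrank_tr -mxrank_gen im0 mxrank0.
have rk1 : \rank T = n1.
  by rewrite -mxrank_tr -mxrank_gen; apply/eqP.
have [|ker0|kerT] := irr2 (kermx T^T).
  move=> g Pg; apply/sub_kermxP.
  by rewrite -mulmxA -trmx_mul -TP // trmx_mul mulmxA mulmx_ker mul0mx.
- right; split => //; rewrite -mxrank_tr; apply/eqP.
  by rewrite -[_ == _]/(row_free _) -kermx_eq0 ker0.
left; apply/trmx_inj; rewrite trmx0.
by apply: (row_full_inj kerT); rewrite mulmx_ker mulmx0.
Qed.

(** An eigenvalue a exists because R[i] is algebraically closed and n > 0. Then T - a is a singular
    intertwiner, hence zero. *)
Lemma intertwiner_scalar n (rho : G -> 'M[R[i]]_n) (T : 'M[R[i]]_n) :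
  mx_irr_on P rho -> (forall g, P g -> rho g *m T = T *m rho g) ->
  exists a, T = a%:M.
Proof.
move=> irr1 TP; have [a /eigenvalueP [v vT v0]] := eigenvalue_closed T irr1.1.
exists a; apply/eqP; rewrite -subr_eq0; apply/eqP.
have [g Pg|//|[rk _]] := intertwiner_rank (T := T - a%:M) irr1 irr1.
  by rewrite mulmxBr mulmxBl TP // scalar_mxC.
have /row_freeP [B TB] : row_free (T - a%:M) by apply/eqP.
by case/eqP: v0; rewrite -(mulmx1 v) -TB mulmxA mulmxBr vT mul_mx_scalar subrr mul0mx.
Qed.

End SchurLemma.

(** * Tensor powers and the unitary trick *)

Section TensorPower.
Variables (R : realType) (d t : nat).
Local Notation C := R[i].
Local Notation tp := (@tpow R d t).

Lemma sum_mindex (H : mindex d t -> C) :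
  \sum_f H f = \sum_(k < dimH d t) H (enum_val k).
Proof.
rewrite (reindex (fun k : 'I_(dimH d t) => enum_val k)) //.
by exists enum_rank => k _; [apply: enum_valK | apply: enum_rankK].
Qed.

Lemma tpowM (X Y : 'M[C]_d) : tp (X *m Y) = tp X *m tp Y.
Proof.
apply/matrixP => i j; rewrite !mxE.
under eq_bigr do rewrite mxE.
rewrite bigA_distr_bigA /= sum_mindex.
apply: eq_bigr => k _; rewrite !mxE -big_split /=.
by apply: eq_bigr => s _.
Qed.

Lemma tpowZ (a : C) (X : 'M[C]_d) : tp (a *: X) = a ^+ t *: tp X.
Proof.
apply/matrixP => i j; rewrite !mxE.
under eq_bigr do rewrite mxE.
by rewrite big_split /= prodr_const card_ord.
Qed.

Lemma tpow_adj (X : 'M[C]_d) : tp (X ^t*) = (tp X) ^t*.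
Proof.
apply/matrixP => i j; rewrite !mxE rmorph_prod.
by apply: eq_bigr => s _; rewrite !mxE.
Qed.

Lemma tpow_diag (e : 'rV[C]_d) : tp (diag_mx e) =
  diag_mx (\row_i \prod_(s < t) e 0 ((enum_val i : mindex d t) s)).
Proof.
apply/matrixP => i j; rewrite !mxE; case: eqVneq => [->|neq] /=.
  by rewrite mulr1n; apply: eq_bigr => s _; rewrite mxE eqxx mulr1n.
have /existsP [s ns] : [exists s, (enum_val i : mindex d t) s != (enum_val j : mindex d t) s].
  rewrite -negb_forall; apply: contra neq => /forallP eqs.
  by apply/eqP/enum_val_inj/ffunP => s; apply/eqP.
by rewrite mulr0n (bigD1 s) //= mxE (negPf ns) mulr0n mul0r.
Qed.

Lemma tpow1 : tp 1%:M = 1%:M.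
Proof.
rewrite -diag_const_mx tpow_diag -diag_const_mx; congr diag_mx.
by apply/rowP => i; rewrite !mxE big1 // => s _; rewrite mxE.
Qed.

(** Equal factors are collected: the exponent of e_a is the occupation number of a in the
    multi-index, so this is a torus weight. *)
Lemma prod_mindex (e : 'rV[C]_d) (f : mindex d t) :
  \prod_(s < t) e 0 (f s) = \prod_a e 0 a ^+ #|[pred s | f s == a]|.
Proof.
rewrite (partition_big (fun s => f s) xpredT) //=.
by apply: eq_bigr => a _; rewrite -prodr_const; apply: eq_big => [s|s /eqP ->].
Qed.

(* The weights of the torus of diagonal unitaries separate the occupation
   numbers (at most t) once a primitive (t+1)-st root of unity is available. *)
Lemma torus_comm_diag (X : 'M[C]_(dimH d t)) :
  (forall e, diag_mx e \is unitarymx -> comm_mx X (tp (diag_mx e))) ->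
  forall e, comm_mx X (tp (diag_mx e)).
Proof.
move=> XT e; have [w wP] := @prim_root_exists C t.+1 isT.
have w1 : `|w| = 1.
  by apply: (@norm_root1 _ _ t.+1) => //; rewrite (prim_expr_order wP) normr1.
apply/matrixP => i j; rewrite tpow_diag mul_mx_diag mul_diag_mx !mxE mulrC.
have [->|Xij] := eqVneq (X i j) 0; first by rewrite !mulr0.
(* A nonzero entry X_ij forces the multi-indices i and j to have the same occupation number of every
   letter a; this is tested with the unitary having [w] at a and 1 elsewhere. *)
congr (_ * _); rewrite !prod_mindex; apply: eq_bigr => a _; congr (_ ^+ _).
pose ea : 'rV[C]_d := \row_b (if b == a then w else 1).
have /XT : diag_mx ea \is unitarymx.
  apply/unitarymxP; rewrite tr_diag_mx map_diag_mx mulmx_diag -diag_const_mx.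
  congr diag_mx; apply/rowP => b; rewrite !mxE.
  by case: eqP => _; rewrite -normCK ?w1 ?normr1 expr1n.
have prod_ea (f : mindex d t) : \prod_(s < t) ea 0 (f s) = w ^+ #|[pred s | f s == a]|.
  rewrite prod_mindex (bigD1 a) //= big1 ?mxE ?eqxx ?mulr1 // => b ba.
  by rewrite mxE (negPf ba) expr1n.
move=> /matrixP /(_ i j).
rewrite tpow_diag mul_mx_diag mul_diag_mx !mxE mulrC => /(mulIf Xij).
rewrite !prod_ea => /eqP; rewrite (eq_prim_root_expr wP) !modn_small ?ltnS;
  try by rewrite -[X in (_ <= X)%N]card_ord max_card.
by move=> /eqP.
Qed.

(* Weyl's unitary trick: diagonal torus first, then GL(d) = U(d) T U(d). *)
Lemma SU_comm_GL (X : 'M[C]_(dimH d t)) : (0 < d)%N ->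
  (forall U, @SUset R d U -> comm_mx X (tp U)) ->
  forall M, M \in unitmx -> comm_mx X (tp M).
Proof.
move=> d_gt0 XSU.
have XU U : U \is unitarymx -> comm_mx X (tp U).
  (* Dividing [U] by a d-th root of its determinant lands in SU(d); the phase reappears as the
     scalar c^t, which commutes with everything. *)
  move=> Uu; pose c := d.-root (\det U).
  have cd : c ^+ d = \det U by rewrite rootCK.
  have c1 : `|c| = 1.
    apply: (norm_root1 d_gt0); rewrite cd; apply: (@norm_root1 _ _ 2) => //.
    have := congr1 determinant (unitarymxP Uu).
    by rewrite det_mulmx det_map_mx det_tr det1 normrX -normCK.
  have c0 : c != 0 by rewrite -normr_eq0 c1 oner_eq0.
  have -> : U = c *: (c^-1 *: U) by rewrite scalerA mulfV // scale1r.
  rewrite tpowZ /comm_mx -scalemxAr -scalemxAl XSU //; split.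
    rewrite adjZ -scalemxAl -scalemxAr scalerA (unitarymxP Uu).
    by rewrite fmorphV -invfM -normCK c1 expr1n invr1 scale1r.
  by rewrite detZ exprVn cd mulVf // -cd expf_neq0.
move=> M /unitmx_svd [Q [S [e [Qu Su _ ->]]]].
rewrite !tpowM; apply: comm_mxM; last exact: XU.
by apply: comm_mxM; [exact: XU | apply: torus_comm_diag => e' /XU].
Qed.

End TensorPower.

(** * The Schur basis and the commutant of the tensor powers *)

Section SchurBasis.
Variables (R : realType) (d t : nat).
Local Notation C := R[i].
Variables (DL DV : YD d t -> nat)
  (vec : forall k, 'I_(DL k) -> 'I_(DV k) -> 'cV[C]_(dimH d t))
  (pi : forall k, 'M[C]_d -> 'M[C]_(DL k))
  (sigma : forall k, 'S_t -> 'M[C]_(DV k)).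
Arguments vec : clear implicits.
Hypothesis sb : is_schur_basis vec pi sigma.

Local Notation P k := (@PiKL R d t DL DV vec k).

Lemma vec_dot k m l m' l' :
  (vec k m l) ^t* *m vec k m' l' = ((m == m') && (l == l'))%:R%:M.
Proof. by rewrite [LHS]mx11_scalar -/(inner _ _) sb.1 eqxx. Qed.

Lemma vec_dot_neq k k' m l m' l' : k != k' ->
  (vec k m l) ^t* *m vec k' m' l' = 0.
Proof. by move=> /negPf kk; rewrite [LHS]mx11_scalar -/(inner _ _) sb.1 kk -scalemx1 scale0r. Qed.

(** With the basis vectors as columns of [W], orthonormality says that the adjoint of [W] is a left
    inverse. The dimension count makes [W] square, up to a propositional equation, so it is also a
    right inverse: the resolution of the identity. *)
Lemma sum_PiK : \sum_k PiK vec k = 1%:M.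
Proof.
pose T : finType := {k : YD d t & ('I_(DL k) * 'I_(DV k))%type}.
pose v (x : T) := vec (tag x) (tagged x).1 (tagged x).2.
pose W : 'M[C]_(dimH d t, #|T|) := \matrix_(i, j) v (enum_val j) i 0.
have vE x y : (v x) ^t* *m v y = (x == y)%:R%:M.
  case: x y => [k [m l]] [k' [m' l']]; rewrite /v /=.
  case: (eqVneq k k') m' l' => [<-|kk] m' l'.
    by rewrite vec_dot eq_Tagged.
  by rewrite vec_dot_neq // /eq_op /= /tag_eq /= (negPf kk) -scalemx1 scale0r.
have WW : W ^t* *m W = 1%:M.
  apply/matrixP => i j; rewrite !mxE.
  have := congr1 (fun A : 'M[C]_1 => A 0 0) (vE (enum_val i) (enum_val j)).
  rewrite !mxE (inj_eq enum_val_inj) mulr1n => <-.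
  by apply: eq_bigr => a _; rewrite !mxE.
have card_T : #|T| = dimH d t.
  rewrite card_tagged -[RHS](sb.2.1) sumnE big_map big_enum /=.
  by apply: eq_bigr => k _; rewrite card_prod !card_ord.
have := mulmx1C_eq card_T WW => <-.
apply/matrixP => i j; rewrite summxE [RHS]mxE.
transitivity (\sum_(x : T) v x i 0 * (v x j 0)^*); last first.
  rewrite (reindex (fun k : 'I_#|T| => enum_val k)) /=; last first.
    by exists enum_rank => k _; [apply: enum_valK | apply: enum_rankK].
  by apply: eq_bigr => x _; rewrite !mxE.
pose G k m l := vec k m l i 0 * (vec k m l j 0)^*.
transitivity (\sum_k \sum_(p : 'I_(DL k) * 'I_(DV k)) G k p.1 p.2).
  apply: eq_bigr => k _; rewrite -(pair_bigA _ (G k)) /PiK summxE.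
  apply: eq_bigr => m _; rewrite summxE; apply: eq_bigr => l _.
  by rewrite !mxE big_ord1 !mxE.
by rewrite sig_big_dep.
Qed.

Lemma basis_ext n (A B : 'M[C]_(n, dimH d t)) :
  (forall k m l, A *m vec k m l = B *m vec k m l) -> A = B.
Proof.
move=> AB; rewrite -(mulmx1 A) -(mulmx1 B) -sum_PiK !mulmx_sumr.
apply: eq_bigr => k _; rewrite /PiK !mulmx_sumr; apply: eq_bigr => m _.
by rewrite !mulmx_sumr; apply: eq_bigr => l _; rewrite !mulmxA AB.
Qed.

Lemma basis_ext2 (A B : 'M[C]_(dimH d t)) :
  (forall k m l k' m' l', (vec k m l) ^t* *m A *m vec k' m' l' =
     (vec k m l) ^t* *m B *m vec k' m' l') -> A = B.
Proof.
move=> AB; apply: basis_ext => k' m' l'; apply: adj_inj.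
apply: basis_ext => k m l; apply: adj_inj.
by rewrite !adjM !trmxCK !mulmxA.
Qed.

Lemma PiKL_adj k l1 l2 : (P k l1 l2) ^t* = P k l2 l1.
Proof.
by rewrite adj_sum; apply: eq_bigr => m _; rewrite adjM trmxCK.
Qed.

Lemma PiK_adj k : (PiK vec k) ^t* = PiK vec k.
Proof.
rewrite adj_sum; apply: eq_bigr => m _.
by rewrite adj_sum; apply: eq_bigr => l _; rewrite adjM trmxCK.
Qed.

Lemma PiKE k : PiK vec k = \sum_l P k l l.
Proof. by rewrite exchange_big. Qed.

Lemma PiKL_vec k l1 l2 m l :
  P k l1 l2 *m vec k m l = (l2 == l)%:R *: vec k m l1.
Proof.
rewrite mulmx_suml (bigD1 m) //= big1 => [|m' mm].
  by rewrite addr0 -mulmxA vec_dot eqxx mul_mx_scalar.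
by rewrite -mulmxA vec_dot (negPf mm) mul_mx_scalar scale0r.
Qed.

Lemma PiKL_vec_neq k k' l1 l2 m l : k != k' -> P k l1 l2 *m vec k' m l = 0.
Proof.
by move=> kk; rewrite mulmx_suml big1 // => m' _; rewrite -mulmxA vec_dot_neq // mulmx0.
Qed.

(** On the k-th block these operators are 1 (x) E_{l1 l2}, hence multiply like matrix units. *)
Lemma PiKL_mul k l1 l2 l3 l4 :
  P k l1 l2 *m P k l3 l4 = (l2 == l3)%:R *: P k l1 l4.
Proof.
rewrite [in LHS]/PiKL mulmx_sumr scaler_sumr; apply: eq_bigr => m _.
by rewrite mulmxA -/(P k l1 l2) PiKL_vec scalemxAl.
Qed.

Lemma PiKL_mul_neq k k' l1 l2 l3 l4 : k != k' ->
  P k l1 l2 *m P k' l3 l4 = 0.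
Proof.
move=> kk; rewrite [X in _ *m X]/PiKL mulmx_sumr big1 // => m _.
by rewrite mulmxA PiKL_vec_neq // mul0mx.
Qed.

Lemma tr_mul_PiKL X k l1 l2 :
  \tr (X *m P k l1 l2) = \sum_m ((vec k m l2) ^t* *m X *m vec k m l1) 0 0.
Proof.
rewrite mulmx_sumr raddf_sum; apply: eq_bigr => m _.
by rewrite /= mulmxA mxtrace_mulC mulmxA [X in mxtrace X]mx11_scalar mxtrace_scalar mulr1n.
Qed.

Lemma tpow_vec X k m l : X \in unitmx ->
  tpow t X *m vec k m l = \sum_m' pi k X m' m *: vec k m' l.
Proof. by move=> Xu; apply: sb.2.2.1. Qed.

(** The two operators act on different tensor factors of the block: [pi k X] on the index m, the
    matrix unit on the index l. *)
Lemma tpow_PiKL X k l1 l2 : X \in unitmx ->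
  tpow t X *m P k l1 l2 = P k l1 l2 *m tpow t X.
Proof.
move=> Xu; apply: basis_ext => k' m l; rewrite -!mulmxA tpow_vec // mulmx_sumr.
under eq_bigr do rewrite -scalemxAr.
case: (eqVneq k k') m l => [<-|kk] m l; last first.
  rewrite PiKL_vec_neq // mulmx0 big1 // => m' _.
  by rewrite PiKL_vec_neq // scaler0.
rewrite PiKL_vec -scalemxAr tpow_vec // scaler_sumr.
by apply: eq_bigr => m' _; rewrite PiKL_vec !scalerA mulrC.
Qed.

Lemma vec_tpow X k m l : X \in unitmx ->
  (vec k m l) ^t* *m tpow t X = \sum_m' pi k X m m' *: (vec k m' l) ^t*.
Proof.
move=> Xu; apply: basis_ext => k' m' l'; rewrite -mulmxA tpow_vec //.
rewrite mulmx_sumr mulmx_suml.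
case: (eqVneq k k') m' l' => [<-|kk] m' l'; last first.
  rewrite !big1 // => a _; first by rewrite -scalemxAl vec_dot_neq ?scaler0.
  by rewrite -scalemxAr vec_dot_neq ?scaler0.
rewrite (bigD1 m) //= [RHS](bigD1 m') //= !big1 => [|a am|a am].
- by rewrite !addr0 -scalemxAl -scalemxAr !vec_dot !eqxx.
- by rewrite -scalemxAl vec_dot (negPf am) -scalemx1 scale0r scaler0.
- by rewrite -scalemxAr vec_dot eq_sym (negPf am) -scalemx1 scale0r scaler0.
Qed.

Lemma DL_gt0 k : (0 < DL k)%N.
Proof. by have [[]] := sb.2.2.2.2.1 k. Qed.

(** Both sides are the matrix element of M^{(x)t} X between two basis vectors: M^{(x)t} acts on the
    bra directly, or on the ket after commuting past X. Fixing l and l' thus cuts X into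
    intertwiners between [pi k] and [pi k']. *)
Lemma commutant_block (X : 'M[C]_(dimH d t)) k l k' l' :
  (forall M, M \in unitmx -> comm_mx X (tpow t M)) ->
  let T := \matrix_(m, m') ((vec k m l) ^t* *m X *m vec k' m' l') 0 0 in
  forall M, @GLset R d M -> pi k M *m T = T *m pi k' M.
Proof.
move=> XGL T M Mu; apply/matrixP => m m'; rewrite !mxE.
transitivity (((vec k m l) ^t* *m tpow t M *m X *m vec k' m' l') 0 0).
  rewrite vec_tpow // !mulmx_suml summxE; apply: eq_bigr => a _.
  by rewrite -!scalemxAl !mxE.
rewrite -(mulmxA _ _ X) -XGL // -!mulmxA tpow_vec // !mulmx_sumr summxE.
by apply: eq_bigr => a _; rewrite -!scalemxAr !mulmxA [LHS]mxE [X in _ = X * _]mxE mulrC.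
Qed.

Lemma TU_vec_neq k k' X m l : k != k' -> TU vec k X *m vec k' m l = 0.
Proof.
move=> kk; rewrite -scalemxAl mulmx_suml big1 ?scaler0 // => l1 _.
by rewrite mulmx_suml big1 // => l2 _; rewrite -scalemxAl PiKL_vec_neq // scaler0.
Qed.

Lemma TU_vec k X m l : TU vec k X *m vec k m l =
  (DL k)%:R^-1 *: \sum_l1 \tr (X *m P k l l1) *: vec k m l1.
Proof.
rewrite -scalemxAl mulmx_suml; congr (_ *: _); apply: eq_bigr => l1 _.
rewrite mulmx_suml (bigD1 l) //= big1 => [|l2 ll].
  by rewrite addr0 -scalemxAl PiKL_vec eqxx scale1r PiKL_adj.
by rewrite -scalemxAl PiKL_vec (negPf ll) scale0r scaler0.
Qed.

(** Matrix elements are compared. For k != k' the block of X is zero, since a nonzero one would be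
    an equivalence of [pi k] and [pi k']. For k = k' it is a scalar a, and Tr(X P_k^{l' l}) = D_L a,
    which the factor 1/D_L in [TU] turns back into a. *)
Lemma commutant_TU (X : 'M[C]_(dimH d t)) :
  (forall M, M \in unitmx -> comm_mx X (tpow t M)) ->
  X = \sum_k TU vec k X.
Proof.
move=> XGL; have DLC k : (DL k)%:R != 0 :> C by rewrite pnatr_eq0 -lt0n DL_gt0.
have irrGL k := (sb.2.2.2.2.1 k).1.
apply: basis_ext2 => k m l k' m' l'.
rewrite -[RHS]mulmxA mulmx_suml (bigD1 k') //= big1 => [|k2 kk2]; last exact: TU_vec_neq.
rewrite addr0 TU_vec -scalemxAr mulmx_sumr [LHS]mx11_scalar.
case: (eqVneq k k') m' l' => [<-|kk] m' l'; last first.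
  have TP := commutant_block (k := k) (k' := k') l l' XGL.
  rewrite big1 ?scaler0 => [|l1 _]; last by rewrite -scalemxAr vec_dot_neq ?scaler0.
  set T := (\matrix_(_, _) _) in TP.
  suff T0 : T = 0.
    by have := congr1 (fun A : 'M[C]_(_, _) => A m m') T0;
      rewrite !mxE => ->; rewrite -scalemx1 scale0r.
  have [//|[rk1 rk2]] := intertwiner_rank (irrGL k) (irrGL k') TP.
  case: (sb.2.2.2.2.2.1 k k' kk); split; first exact: etrans (esym rk1) rk2.
  by exists T.
have TP := commutant_block (k := k) (k' := k) l l' XGL.
have [a Ta] := intertwiner_scalar (irrGL k) TP.
have TE m1 m2 : ((vec k m1 l) ^t* *m X *m vec k m2 l') 0 0 = a *+ (m1 == m2).
  by have := congr1 (fun A : 'M[C]_(_, _) => A m1 m2) Ta; rewrite [LHS]mxE => ->; rewrite mxE.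
rewrite TE (bigD1 l) //= big1 => [|l1 ll]; last first.
  by rewrite -scalemxAr vec_dot [l == _]eq_sym (negPf ll) andbF -scalemx1 scale0r scaler0.
rewrite addr0 -scalemxAr vec_dot eqxx andbT tr_mul_PiKL.
under eq_bigr do rewrite TE eqxx.
rewrite sumr_const card_ord scalerA -[a *+ 1]/a -(mulr_natl a (DL k)) mulKf //.
by rewrite scale_scalar_mx mulr_natr.
Qed.

End SchurBasis.

(** * The maps T_U^(k) as orthogonal projections *)

Section TwirlAlgebra.
Variables (R : realType) (d t : nat).
Local Notation C := R[i].
Variables (DL DV : YD d t -> nat)
  (vec : forall k, 'I_(DL k) -> 'I_(DV k) -> 'cV[C]_(dimH d t))
  (pi : forall k, 'M[C]_d -> 'M[C]_(DL k))
  (sigma : forall k, 'S_t -> 'M[C]_(DV k)).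
Hypothesis sb : is_schur_basis vec pi sigma.

Local Notation P k := (@PiKL R d t DL DV vec k).
Local Notation TU := (TU vec).

(** The product is pi_k(Y) (x) E_{l l'} on block k, and the trace factors. *)
Lemma tr_tpow_PiKL Y k l l' : Y \in unitmx ->
  \tr (tpow t Y *m P k l l') = (l == l')%:R * \tr (pi k Y).
Proof.
move=> Yu; rewrite tr_mul_PiKL mulr_sumr; apply: eq_bigr => m _.
rewrite -mulmxA (tpow_vec sb) // mulmx_sumr (bigD1 m) //= big1 => [|a am].
  by rewrite addr0 -scalemxAr (vec_dot sb) eqxx eq_sym !mxE mulr1n mulrC.
by rewrite -scalemxAr (vec_dot sb) eq_sym (negPf am) -scalemx1 scale0r scaler0.
Qed.

Lemma DV_gt0 k : (0 < DV k)%N.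
Proof. by have [] := sb.2.2.2.2.2.2.1 k. Qed.

Lemma TU_is_linear k : linear (TU k).
Proof.
move=> a X Y; rewrite /Defs.TU scalerA mulrC -scalerA -scalerDr; congr (_ *: _).
rewrite scaler_sumr -big_split; apply: eq_bigr => l1 _ /=.
rewrite scaler_sumr -big_split; apply: eq_bigr => l2 _ /=.
by rewrite mulmxDl -scalemxAl linearP scalerDl scalerA.
Qed.

HB.instance Definition _ k :=
  GRing.isLinear.Build C 'M[C]_(dimH d t) 'M[C]_(dimH d t) _ (TU k) (@TU_is_linear k).

Lemma TUZ k a X : TU k (a *: X) = a *: TU k X.
Proof. exact: linearZ_LR. Qed.

Lemma PiKL_tr k l1 l2 : \tr (P k l1 l2) = (l1 == l2)%:R * (DL k)%:R.
Proof.
rewrite -[P _ _ _]mul1mx tr_mul_PiKL.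
under eq_bigr do rewrite mulmx1 (vec_dot sb) eqxx /= mxE mulr1n.
by rewrite sumr_const card_ord eq_sym mulr_natr.
Qed.

Lemma TU_PiKL k l1 l2 : TU k (P k l1 l2) = P k l1 l2.
Proof.
rewrite /Defs.TU (bigD1 l1) //= [X in _ + X]big1 => [|a al]; last first.
  rewrite big1 // => b _.
  rewrite PiKL_adj (PiKL_mul sb) linearZ /= PiKL_tr [l1 == _]eq_sym.
  by rewrite (negPf al) mul0r mulr0 scale0r.
rewrite addr0 (bigD1 l2) //= big1 => [|b bl]; last first.
  by rewrite PiKL_adj (PiKL_mul sb) eq_sym (negPf bl) scale0r raddf0 scale0r.
rewrite addr0 PiKL_adj (PiKL_mul sb) eqxx scale1r PiKL_tr eqxx mul1r scalerA mulVf ?scale1r //.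
by rewrite pnatr_eq0 -lt0n (DL_gt0 sb).
Qed.

Lemma TU_PiKL_neq k k' l1 l2 : k != k' -> TU k (P k' l1 l2) = 0.
Proof.
move=> kk; rewrite /Defs.TU big1 ?scaler0 // => a _; rewrite big1 // => b _.
by rewrite PiKL_adj (PiKL_mul_neq sb) 1?eq_sym // raddf0 scale0r.
Qed.

(** [TU k] is the Hilbert-Schmidt projection onto the span of the [P k l1 l2], each of squared norm
    D_L, and these spans are orthogonal for distinct k. *)
Lemma TU_idem k k' X : TU k (TU k' X) = (k == k')%:R *: TU k X.
Proof.
case: eqVneq => [<-|kk].
  rewrite scale1r {2}/Defs.TU linearZ linear_sum; congr (_ *: _).
  apply: eq_bigr => a _; rewrite linear_sum; apply: eq_bigr => b _.
  by rewrite linearZ /= TU_PiKL.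
rewrite scale0r {2}/Defs.TU linearZ linear_sum /= big1 ?scaler0 // => a _.
by rewrite linear_sum big1 // => b _; rewrite linearZ /= TU_PiKL_neq // scaler0.
Qed.

Lemma tr_TU k X : \tr (TU k X) = \tr (X *m (PiK vec k) ^t*).
Proof.
rewrite /Defs.TU mxtraceZ raddf_sum PiK_adj PiKE mulmx_sumr raddf_sum mulr_sumr.
apply: eq_bigr => l _; rewrite raddf_sum (bigD1 l) //= big1 => [|b bl].
  rewrite addr0 mxtraceZ PiKL_tr eqxx mul1r PiKL_adj mulrCA mulVf ?mulr1 //.
  by rewrite pnatr_eq0 -lt0n (DL_gt0 sb).
by rewrite mxtraceZ PiKL_tr eq_sym (negPf bl) mul0r mulr0.
Qed.

Lemma TU_mul_PiKL k X l1 l2 : (\sum_k' TU k' X) *m P k l1 l2 =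
  (DL k)%:R^-1 *: \sum_a \tr (X *m P k l1 a) *: P k a l2.
Proof.
rewrite mulmx_suml (bigD1 k) //= [X in _ + X]big1 => [|k' kk]; last first.
  rewrite -scalemxAl mulmx_suml big1 ?scaler0 // => a _.
  by rewrite mulmx_suml big1 // => b _; rewrite -scalemxAl (PiKL_mul_neq sb) // scaler0.
rewrite addr0 -scalemxAl mulmx_suml; congr (_ *: _); apply: eq_bigr => a _.
rewrite mulmx_suml (bigD1 l1) //= big1 => [|b bl].
  by rewrite addr0 -scalemxAl (PiKL_mul sb) eqxx scale1r PiKL_adj.
by rewrite -scalemxAl (PiKL_mul sb) (negPf bl) scale0r scaler0.
Qed.

Variables (S : 'M[C]_(dimH d t)) (b : YD d t -> C).
Hypothesis Sb : forall k l l', \tr (S *m P k l l') = (l == l')%:R * b k.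

Lemma tr_mul_PiK k : \tr (S *m (PiK vec k) ^t*) = (DV k)%:R * b k.
Proof.
rewrite PiK_adj PiKE mulmx_sumr raddf_sum /=.
under eq_bigr do rewrite Sb eqxx mul1r.
by rewrite sumr_const card_ord mulr_natl.
Qed.

(** [S] stands for the average of (A_n^{(x)t})^2 and [Y] for N(G(X)). Multiplying the sum of the
    [TU k' X] by P_k^{l2 l1} leaves a combination of the P_k^{a l1}, of which the trace against [S]
    keeps only a = l1; every coefficient of [TU k X] is therefore scaled by the same number. *)
Lemma TU_filter k X Y :
  (forall l l', \tr (Y *m P k l l') = \tr (S *m (\sum_k' TU k' X) *m P k l l')) ->
  TU k Y = (\tr (S *m (PiK vec k) ^t*) / (DL k * DV k)%N%:R) *: TU k X.
Proof.
move=> YX.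
(* Tr(S Pi_k) consists of D_V equal traces [b k], so beta_k / D^k is [b k] / D_L. *)
have -> : \tr (S *m (PiK vec k) ^t*) / (DL k * DV k)%N%:R = (DL k)%:R^-1 * b k.
  rewrite tr_mul_PiK natrM invfM mulrCA [_ * b k]mulrC mulfK //.
  by rewrite pnatr_eq0 -lt0n DV_gt0.
rewrite /Defs.TU -[RHS]scalerA; congr (_ *: _); rewrite scalerA scaler_sumr.
apply: eq_bigr => l1 _; rewrite scaler_sumr.
apply: eq_bigr => l2 _; rewrite scalerA; congr (_ *: _).
rewrite PiKL_adj YX -mulmxA TU_mul_PiKL -scalemxAr mxtraceZ mulmx_sumr raddf_sum /=.
rewrite (bigD1 l1) //= big1 => [|a al].
  rewrite addr0 -scalemxAr mxtraceZ Sb eqxx mul1r.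
  by rewrite [_ * b k]mulrC mulrA [_^-1 * _]mulrC.
by rewrite -scalemxAr mxtraceZ Sb (negPf al) mul0r mulr0.
Qed.

End TwirlAlgebra.

(** * Integrals over a set of full measure *)

Section FullMeasure.
Context (dT : measure_display) (T : measurableType dT) (R : realType).
Variables (mu : probability T R) (B : set T).
Hypotheses (mB : measurable B) (muB : mu B = 1%E).
Local Open Scope ereal_scope.
Import HBNNSimple.

Lemma measure_full (A : set T) : measurable A -> mu (A `&` B) = mu A.
Proof.
move=> mA; rewrite [RHS](measureDI mu mA mB) [X in X + _](_ : _ = 0) ?add0e //.
apply/eqP; rewrite eq_le measure_ge0 andbT.
have <- : mu (~` B) = 0 by rewrite probability_setC // muB subee.
by apply: le_measure; rewrite ?inE; [apply: measurableD | apply: measurableC | apply: subDsetr].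
Qed.

(* The integral of the library is a supremum over simple functions, so no
   measurability of f is needed here; opnorm is only shown to be measurable
   on the set of full measure. *)
Lemma ge0_integral_full (f : T -> \bar R) : (forall x, 0 <= f x) ->
  \int[mu]_x f x = \int[mu]_(x in B) f x.
Proof.
move=> f0; rewrite !ge0_integralE //.
apply/eqP; rewrite eq_le; apply/andP; split; last first.
  apply: ereal_sup_le => _ [h hf <-]; exists h => // x.
  apply: (le_trans (hf x)); rewrite patch_setT /patch.
  by case: ifP.
apply: ge_ereal_sup => _ [h hf <-]; apply: ereal_sup_ubound.
(* The simple function [h] is cut to zero off [B]: the value 0 contributes nothing, and the
   preimages of the other values lose only a null set. *)
exists (proj_nnsfun h mB).
  move=> x; rewrite -mrestrict /patch; case: ifP => // _.
  by apply: (le_trans (hf x)); rewrite patch_setT.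
rewrite !sintegralET; apply: eq_fsbigr => r _.
have [->|r0] := eqVneq r 0%R; first by rewrite !mul0e.
congr (_ * _); rewrite -mrestrict -[RHS]measure_full //; congr (mu _).
apply/seteqP; split => x /=; rewrite /patch.
  by case: ifPn => [/set_mem xB|_ r0']; [|rewrite -r0' eqxx in r0].
by move=> [hx xB]; rewrite mem_set.
Qed.

Lemma integral_full (f : T -> \bar R) :
  \int[mu]_x f x = \int[mu]_(x in B) f x.
Proof. by rewrite integralE [RHS]integralE -!ge0_integral_full. Qed.

Lemma Rintegral_full (f : T -> R) :
  Rintegral mu setT f = Rintegral mu B f.
Proof. by rewrite /Rintegral integral_full. Qed.

End FullMeasure.

(** * Function algebras closed under conjugation *)

Section FunctionAlgebra.
Variables (R : realType) (T : Type).
Local Notation C := R[i].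

(** Entries of matrix products, adjoints and tensor powers are polynomials in the given entries and
    their conjugates. One closure argument then serves both measurability on the whole space and
    integrability on [B]. *)
Record star_algebra (Q : (T -> C) -> Prop) : Prop := StarAlgebra {
  sa_cst : forall a, Q (fun=> a);
  sa_add : forall f g, Q f -> Q g -> Q (fun x => f x + g x);
  sa_mul : forall f g, Q f -> Q g -> Q (fun x => f x * g x);
  sa_conj : forall f, Q f -> Q (fun x => (f x)^*) }.

Variables (Q : (T -> C) -> Prop) (QA : star_algebra Q).

Lemma sa_sum (I : finType) (f : I -> T -> C) :
  (forall i, Q (f i)) -> Q (fun x => \sum_i f i x).
Proof.
move=> Qf; elim: (index_enum I) => [|i s IHs].
  by under eq_fun do rewrite big_nil; apply: sa_cst.
by under eq_fun do rewrite big_cons; apply: sa_add.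
Qed.

Lemma sa_prod (I : finType) (f : I -> T -> C) :
  (forall i, Q (f i)) -> Q (fun x => \prod_i f i x).
Proof.
move=> Qf; elim: (index_enum I) => [|i s IHs].
  by under eq_fun do rewrite big_nil; apply: sa_cst.
by under eq_fun do rewrite big_cons; apply: sa_mul.
Qed.

Definition entrywise m n (F : T -> 'M[C]_(m, n)) := forall i j, Q (fun x => F x i j).

Lemma entrywise_cst m n (A : 'M[C]_(m, n)) : entrywise (fun=> A).
Proof. by move=> i j; apply: sa_cst. Qed.

Lemma entrywise_mulmx m n p (F : T -> 'M[C]_(m, n)) (G : T -> 'M[C]_(n, p)) :
  entrywise F -> entrywise G -> entrywise (fun x => F x *m G x).
Proof.
move=> QF QG i j; under eq_fun do rewrite mxE.
by apply: sa_sum => k; apply: sa_mul.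
Qed.

Lemma entrywise_adj m n (F : T -> 'M[C]_(m, n)) :
  entrywise F -> entrywise (fun x => (F x) ^t*).
Proof. by move=> QF i j; under eq_fun do rewrite !mxE; apply: sa_conj. Qed.

Lemma entrywise_tpow d t (F : T -> 'M[C]_d) :
  entrywise F -> entrywise (fun x => tpow t (F x)).
Proof.
by move=> QF i j; under eq_fun do rewrite mxE; apply: sa_prod => s.
Qed.

End FunctionAlgebra.

(** * Integration of bounded complex functions *)

Section ComplexIntegral.
Context (dT : measure_display) (T : measurableType dT) (R : realType).
Local Notation C := R[i].
Local Notation Re := (@complex.Re R).
Local Notation Im := (@complex.Im R).

Definition cmeasurable (D : set T) (f : T -> C) : Prop :=
  measurable_fun D (fun x => Re (f x)) /\ measurable_fun D (fun x => Im (f x)).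

Definition cbounded (D : set T) (f : T -> C) : Prop :=
  exists M : C, forall x, D x -> `|f x| <= M.

(** For a probability measure, measurable and bounded implies integrable, and unlike integrability
    this condition is stable under products. *)
Definition cintegrable (D : set T) (f : T -> C) : Prop :=
  cmeasurable D f /\ cbounded D f.

Lemma ReD (z w : C) : Re (z + w) = Re z + Re w. Proof. by case: z w => ? ? []. Qed.
Lemma ImD (z w : C) : Im (z + w) = Im z + Im w. Proof. by case: z w => ? ? []. Qed.
Lemma ReM (z w : C) : Re (z * w) = Re z * Re w - Im z * Im w.
Proof. by case: z w => ? ? []. Qed.
Lemma ImM (z w : C) : Im (z * w) = Re z * Im w + Im z * Re w.
Proof. by case: z w => ? ? []. Qed.

Lemma Re_conj (z : C) : Re z^* = Re z.
Proof. by case: z. Qed.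
Lemma Im_conj (z : C) : Im z^* = - Im z.
Proof. by case: z. Qed.

Lemma cmeasurable_algebra D : measurable D -> star_algebra (cmeasurable D).
Proof.
move=> mD; split.
- by move=> a; split; apply: measurable_cst.
- move=> f g [rf jf] [rg jg]; split.
    by under eq_fun do rewrite ReD; apply: measurable_funD.
  by under eq_fun do rewrite ImD; apply: measurable_funD.
- move=> f g [rf jf] [rg jg]; split.
    by under eq_fun do rewrite ReM; apply: measurable_funB; apply: measurable_funM.
  by under eq_fun do rewrite ImM; apply: measurable_funD; apply: measurable_funM.
- move=> f [rf jf]; split; first by under eq_fun do rewrite Re_conj.
  by under eq_fun do rewrite Im_conj; apply: measurableT_comp.
Qed.

Lemma cbounded_algebra D : star_algebra (cbounded D).
Proof.
split.
- by move=> a; exists `|a|.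
- move=> f g [M fM] [N gN]; exists (M + N) => x Dx.
  by apply: le_trans (ler_normD _ _) _; apply: lerD; [apply: fM | apply: gN].
- move=> f g [M fM] [N gN]; exists (M * N) => x Dx.
  by rewrite normrM ler_pM ?fM ?gN.
- by move=> f [M fM]; exists M => x Dx; rewrite norm_conjC fM.
Qed.

Lemma cintegrable_algebra D : measurable D -> star_algebra (cintegrable D).
Proof.
move=> mD; have [mc ma mm mj] := cmeasurable_algebra mD.
have [bc ba bm bj] := cbounded_algebra D.
split=> [a|f g [? ?] [? ?]|f g [? ?] [? ?]|f [? ?]]; split.
all: by [apply: mc | apply: bc | apply: ma | apply: ba | apply: mm
  | apply: bm | apply: mj | apply: bj].
Qed.

Variables (mu : probability T R) (B : set T).
Hypotheses (mB : measurable B) (muB : mu B = 1%E).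

Definition Cint (f : T -> C) : C :=
  Complex (Rintegral mu setT (fun x => Re (f x)))
          (Rintegral mu setT (fun x => Im (f x))).

Lemma Cint_full f : Cint f =
  Complex (Rintegral mu B (fun x => Re (f x))) (Rintegral mu B (fun x => Im (f x))).
Proof. by rewrite /Cint !(Rintegral_full mB muB). Qed.

Lemma eq_Cint f g : (forall x, B x -> f x = g x) -> Cint f = Cint g.
Proof.
by move=> fg; rewrite !Cint_full; congr Complex; apply: eq_Rintegral => x;
  rewrite inE => /fg ->.
Qed.

Lemma normc_ge_ReIm (z : C) : `|Re z| <= Re `|z| /\ `|Im z| <= Re `|z|.
Proof.
rewrite normc_def /=; split; rewrite -sqrtr_sqr ler_wsqrtr //.
  by rewrite lerDl sqr_ge0.
by rewrite lerDr sqr_ge0.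
Qed.

Lemma cintegrable_integrable f : cintegrable B f ->
  mu.-integrable B (EFin \o (fun x => Re (f x))) /\
  mu.-integrable B (EFin \o (fun x => Im (f x))).
Proof.
move=> [[mr mi] [M fM]].
have muBy : (mu B < +oo)%E by rewrite muB ltry.
have fM' x : B x -> Re `|f x| <= Re M by move=> /fM; rewrite lecE => /andP[].
by split; apply: measurable_bounded_integrable => //; exists (Re M); split;
  rewrite ?num_real // => M' MM' x Bx; apply: le_trans (ltW MM');
  apply: le_trans (fM' x Bx); have [] := normc_ge_ReIm (f x).
Qed.

Lemma CintD f g : cintegrable B f -> cintegrable B g ->
  Cint (fun x => f x + g x) = Cint f + Cint g.
Proof.
move=> /cintegrable_integrable [rf jf] /cintegrable_integrable [rg jg].
rewrite !Cint_full; apply/eqP; rewrite eq_complex /=; apply/andP; split; apply/eqP.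
  by rewrite -RintegralD //; apply: eq_Rintegral => x _; rewrite ReD.
by rewrite -RintegralD //; apply: eq_Rintegral => x _; rewrite ImD.
Qed.

Lemma CintZ a f : cintegrable B f -> Cint (fun x => a * f x) = a * Cint f.
Proof.
move=> /cintegrable_integrable [rf jf].
have ZR (b : R) (g : T -> R) : mu.-integrable B (EFin \o g) ->
    mu.-integrable B (EFin \o (fun x => b * g x)).
  by move=> ig; exact: (integrableZl mB b ig).
rewrite !Cint_full; apply/eqP; rewrite eq_complex ReM ImM /=.
apply/andP; split; apply/eqP.
  rewrite -!RintegralZl // -RintegralB //; try exact: ZR.
  by apply: eq_Rintegral => x _; rewrite ReM.
rewrite -!RintegralZl // -RintegralD //; try exact: ZR.
by apply: eq_Rintegral => x _; rewrite ImM.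
Qed.

Lemma Cint0 : Cint (fun=> 0) = 0.
Proof. by rewrite /Cint /Rintegral /= integral0. Qed.

Lemma Cint_sum (I : finType) (f : I -> T -> C) :
  (forall i, cintegrable B (f i)) ->
  Cint (fun x => \sum_i f i x) = \sum_i Cint (f i).
Proof.
move=> If; have BA := cintegrable_algebra mB.
suff [] : cintegrable B (fun x => \sum_(i <- index_enum I) f i x) /\
  Cint (fun x => \sum_(i <- index_enum I) f i x) = \sum_(i <- index_enum I) Cint (f i) by [].
elim: (index_enum I) => [|i s [IHi IHe]].
  under eq_fun do rewrite big_nil.
  by rewrite big_nil Cint0; split => //; apply: sa_cst.
under eq_fun do rewrite big_cons.
by rewrite big_cons CintD // IHe; split => //; apply: sa_add.
Qed.

End ComplexIntegral.

(** * Matrix-valued integrals and change of variables *)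

Section MatrixIntegral.
Variables (R : realType) (d : nat).
Local Notation C := R[i].
Local Notation MT := (MatT R d).

Lemma cintE (mu : measure MT R) m n (F : MT -> 'M[C]_(m, n)) i j :
  cint mu F i j = Complex (Rintegral mu setT (fun x => complex.Re (F x i j)))
          (Rintegral mu setT (fun x => complex.Im (F x i j))).
Proof. by rewrite mxE. Qed.

Section Linearity.
Variables (mu : probability MT R) (B : set MT).
Hypotheses (mB : measurable B) (muB : mu B = 1%E).
Local Notation integrablemx := (entrywise (cintegrable B)).

Lemma cint_mulmxl m n p (A : 'M[C]_(m, n)) (F : MT -> 'M[C]_(n, p)) :
  integrablemx F -> cint mu (fun x => A *m F x) = A *m cint mu F.
Proof.
move=> iF; apply/matrixP => i j; have BA := cintegrable_algebra R mB.
have iAF k : cintegrable B (fun x => A i k * F x k j).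
  by apply: (sa_mul BA); [apply: (sa_cst BA) | apply: iF].
rewrite cintE -/(Cint mu (fun x => (A *m F x) i j)).
under eq_fun do rewrite mxE.
rewrite (Cint_sum mB muB iAF) mxE; apply: eq_bigr => k _.
by rewrite (CintZ mB muB) // cintE.
Qed.

Lemma cint_mulmxr m n p (F : MT -> 'M[C]_(m, n)) (A : 'M[C]_(n, p)) :
  integrablemx F -> cint mu (fun x => F x *m A) = cint mu F *m A.
Proof.
move=> iF; apply: trmx_inj; rewrite trmx_mul.
have trE q r (G : MT -> 'M[C]_(q, r)) : (cint mu G)^T = cint mu (fun x => (G x)^T).
  by apply/matrixP => i j; rewrite mxE !cintE; congr Complex;
    apply: eq_Rintegral => x _; rewrite [in RHS]mxE.
rewrite !trE -cint_mulmxl => [|i j]; last by under eq_fun do rewrite mxE; apply: iF.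
by congr cint; apply/funext => x; rewrite trmx_mul.
Qed.

Lemma cint_trace n (F : MT -> 'M[C]_n) :
  integrablemx F -> \tr (cint mu F) = Cint mu (fun x => \tr (F x)).
Proof.
move=> iF; rewrite /mxtrace (Cint_sum mB muB) //.
by apply: eq_bigr => i _; rewrite cintE.
Qed.

End Linearity.

Lemma cmeasurable_entry i j : cmeasurable setT (fun X : MT => X i j).
Proof.
by split=> _ Y mY; rewrite setTI; apply: sub_sigma_algebra;
  exists i, j, Y; split => //; [left | right].
Qed.

Lemma measurable_matT (dT : measure_display) (T : measurableType dT) (F : T -> MT) :
  entrywise (cmeasurable setT) (F : T -> 'M[C]_d) -> measurable_fun setT F.
Proof.
move=> mF; apply: (@measurability _ _ T MT setT F (@entry_gen R d) erefl) => _
  [_ [i [j [Y [mY [->|->]]]]] <-].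
  exact: ((mF i j).1 measurableT).
exact: ((mF i j).2 measurableT).
Qed.

(** Invariance says that [mu] is its own pushforward along [phi]. The change of variables is made
    for nonnegative functions and applied to the positive and negative parts of [f]. *)
Lemma integral_invariant (mu : probability MT R) (phi : MT -> MT) (f : MT -> \bar R) :
  measurable_fun setT phi ->
  (forall S, measurable S -> mu (phi @^-1` S) = mu S) ->
  measurable_fun setT f ->
  (\int[mu]_x f (phi x) = \int[mu]_x f x)%E.
Proof.
move=> mphi inv mf.
have ge0 (g : MT -> \bar R) : measurable_fun setT g -> (forall x, 0 <= g x)%E ->
    (\int[mu]_x g (phi x) = \int[mu]_x g x)%E.
  move=> mg g0; have := ge0_integral_pushforward mphi mu measurableT mg.
  rewrite preimage_setT => <- //.
  by apply: eq_measure_integral => A mA _; apply: inv.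
rewrite integralE [RHS]integralE; congr (_ - _)%E.
  rewrite -(ge0 _ (measurable_funepos mf) (funepos_ge0 f)).
  by apply: eq_integral => x _; rewrite !funeposE.
rewrite -(ge0 _ (measurable_funeneg mf) (funeneg_ge0 f)).
by apply: eq_integral => x _; rewrite !funenegE.
Qed.

Lemma cint_invariant (mu : probability MT R) (phi : MT -> MT) m n
    (F : MT -> 'M[C]_(m, n)) :
  entrywise (cmeasurable setT) (phi : MT -> 'M[C]_d) ->
  (forall S, measurable S -> mu (phi @^-1` S) = mu S) ->
  entrywise (cmeasurable setT) F ->
  cint mu (fun x => F (phi x)) = cint mu F.
Proof.
move=> /measurable_matT mphi inv mF; apply/matrixP => i j; rewrite !cintE.
by congr Complex; congr fine; apply: (integral_invariant (f := fun x => (_ (F x i j))%:E));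
  rewrite //; apply/measurable_EFinP; have [] := mF i j.
Qed.

End MatrixIntegral.

(** * The operator norm of positive diagonal matrices *)

Section OperatorNorm.
Variables (R : realType) (d : nat).
Local Notation C := R[i].

Lemma vnorm_sqr n (v : 'cV[C]_n) :
  vnorm v ^+ 2 = \sum_i (complex.Re (v i 0) ^+ 2 + complex.Im (v i 0) ^+ 2).
Proof. by rewrite sqr_sqrtr //; apply: sumr_ge0 => i _; rewrite addr_ge0 ?sqr_ge0. Qed.

Definition maxdiag (X : 'M[C]_d) : R := \big[Num.max/0]_i complex.Re (X i i).

(** |Xv|^2 is the sum of x_i^2 |v_i|^2, at most the squared maximum for unit v, with equality at the
    basis vector of a largest entry. A supremum over all unit vectors becomes a finite maximum of
    entries, which is visibly measurable. *)
Lemma opnorm_Aset (X : 'M[C]_d) : (0 < d)%N -> @Aset R d X ->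
  opnorm X = maxdiag X.
Proof.
move=> d_gt0 [Xd Xpos _].
have Xre i : 0 < complex.Re (X i i) by have := Xpos i; rewrite ltcE => /andP[].
have Xim i : complex.Im (X i i) = 0 by exact/ger0_Im/ltW.
have XvE v i : (X *m v) i 0 = X i i * v i 0 :> C.
  rewrite mxE (bigD1 i) //= big1 ?addr0 // => j ji.
  by rewrite (is_diag_mxP Xd) ?mul0r // eq_sym.
have Xv_sqr v i : complex.Re ((X *m v) i 0) ^+ 2 + complex.Im ((X *m v) i 0) ^+ 2
    = complex.Re (X i i) ^+ 2 * (complex.Re (v i 0) ^+ 2 + complex.Im (v i 0) ^+ 2).
  by rewrite XvE ReM ImM Xim !mul0r subr0 addr0 !exprMn mulrDr.
have max_ge i : complex.Re (X i i) <= maxdiag X by apply: le_bigmax.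
have max_ge0 : 0 <= maxdiag X by apply: bigmax_ge_id.
have ub (v : 'cV[C]_d) : vnorm v = 1 -> vnorm (X *m v) <= maxdiag X.
  move=> v1; rewrite -(@ler_pXn2r _ 2) ?nnegrE ?sqrtr_ge0 // vnorm_sqr.
  rewrite -[maxdiag X ^+ 2]mulr1 -[1](expr1n _ 2) -[in 1 ^+ 2]v1 vnorm_sqr mulr_sumr.
  apply: ler_sum => i _; rewrite Xv_sqr ler_wpM2r ?addr_ge0 ?sqr_ge0 //.
  by rewrite ler_pXn2r ?nnegrE // ltW.
(* The seed 0 of [maxdiag] lies below every entry, so the maximum is attained at an index. *)
have [i0 maxE] : exists i0, maxdiag X = complex.Re (X i0 i0).
  have := bigmax_eq_arg 0 (Ordinal d_gt0) xpredT (fun i => complex.Re (X i i)) isT.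
  by move=> maxE; eexists; apply: maxE => i _; exact: ltW.
pose e : 'cV[C]_d := delta_mx i0 0.
have vnorm_ge0 n (v : 'cV[C]_n) : 0 <= vnorm v by exact: sqrtr_ge0.
have e1 : vnorm e = 1.
  apply: (@pexpIrn _ 2); rewrite ?nnegrE // expr1n vnorm_sqr.
  rewrite (bigD1 i0) //= big1 => [|j ji]; last by rewrite !mxE (negPf ji) /= expr0n addr0.
  by rewrite !mxE !eqxx /= expr1n expr0n !addr0.
have Xe : vnorm (X *m e) = maxdiag X.
  apply: (@pexpIrn _ 2); rewrite ?nnegrE // vnorm_sqr.
  under eq_bigr do rewrite Xv_sqr.
  rewrite (bigD1 i0) //= big1 => [|j ji].
    by rewrite !mxE !eqxx /= expr1n expr0n !addr0 mulr1 maxE.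
  by rewrite !mxE (negPf ji) /= expr0n addr0 mulr0.
apply/eqP; rewrite eq_le; apply/andP; split.
  by apply: ge_sup => [|_ [v v1 <-]]; [exists (maxdiag X), e | exact: ub].
rewrite -{1}Xe; apply: ub_le_sup; last by exists e.
by exists (maxdiag X) => _ [v v1 <-]; exact: ub.
Qed.

End OperatorNorm.

(** * Boundedness and measurability of the entries of K and A_n *)

Section Integrability.
Variables (R : realType) (d : nat).
Local Notation C := R[i].
Local Notation MT := (MatT R d).

Lemma cmeasurableS (dT : measure_display) (T : measurableType dT) (D : set T) (f : T -> C) :
  cmeasurable setT f -> cmeasurable D f.
Proof. by move=> [? ?]; split; apply: measurable_funTS. Qed.

Lemma SU_unitmx (U : 'M[C]_d) : @SUset R d U -> U \in unitmx.
Proof. by move=> [/mulmx1_unit []]. Qed.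

Lemma SU_integrable (B : set MT) : B `<=` @SUset R d ->
  entrywise (cintegrable B) (fun K : MT => K : 'M[C]_d).
Proof.
move=> BSU i j; split; first exact/cmeasurableS/cmeasurable_entry.
exists 1 => K /BSU [/matrixP /(_ i i) KK _].
(* Row i of a unitary matrix has length 1, so |K_ij|^2 is one term of a sum of nonnegative terms
   equal to 1. *)
rewrite -(@ler_pXn2r _ 2) ?nnegrE // expr1n.
move: KK; rewrite !mxE eqxx mulr1n (bigD1 j) //= !mxE -normCK => <-.
by rewrite lerDl sumr_ge0 // => k _; rewrite !mxE mul_conjC_ge0.
Qed.

Variables (B : set MT).
Hypotheses (d_gt0 : (0 < d)%N) (mB : measurable B) (BA : B `<=` @Aset R d).

Lemma Aset_diag (A : 'M[C]_d) i j : @Aset R d A ->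
  A i j = (complex.Re (A i i))%:C%C *+ (i == j).
Proof.
move=> [Ad Apos _]; case: eqVneq => [<-|ij].
  by rewrite RRe_real // ger0_real // ltW.
exact: (is_diag_mxP Ad).
Qed.

Lemma maxdiag_gt0 (A : 'M[C]_d) : @Aset R d A -> 0 < maxdiag A.
Proof.
move=> [_ Apos _]; have := Apos (Ordinal d_gt0); rewrite ltcE => /andP[_].
by move=> /lt_le_trans; apply; apply: le_bigmax.
Qed.

Lemma nrmzE (A : 'M[C]_d) i j : @Aset R d A ->
  nrmz A i j = ((maxdiag A)^-1 * complex.Re (A i i))%:C%C *+ (i == j).
Proof.
move=> AA; rewrite mxE opnorm_Aset // (Aset_diag i j AA) mulrnAr; congr (_ *+ _).
by rewrite rmorphM.
Qed.

Lemma nrmz_adj (A : 'M[C]_d) : @Aset R d A -> (nrmz A) ^t* = nrmz A.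
Proof.
move=> AA; apply/matrixP => i j; rewrite adjE !nrmzE // [j == i]eq_sym.
case: eqVneq => [->|_]; last by rewrite !mulr0n rmorph0.
by rewrite !mulr1n -[LHS]/(conjc _) conjc_real.
Qed.

Lemma nrmz_unitmx (A : 'M[C]_d) : @Aset R d A -> nrmz A \in unitmx.
Proof.
move=> AA; rewrite unitmxE detZ opnorm_Aset //; case: (AA) => _ _ ->.
rewrite mulr1 unitfE expf_neq0 // eq_complex /= negb_and.
by rewrite invr_eq0 gt_eqF // maxdiag_gt0.
Qed.

Lemma maxdiag_measurable : measurable_fun setT (fun A : MT => maxdiag A).
Proof.
rewrite /maxdiag; elim: (index_enum _) => [|i s IHs].
  by under eq_fun do rewrite big_nil; apply: measurable_cst.
under eq_fun do rewrite big_cons.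
exact: (measurable_maxr ((@cmeasurable_entry R d i i).1) IHs).
Qed.

Lemma nrmz_integrable : entrywise (cintegrable B) (fun A : MT => nrmz A).
Proof.
move=> i j; split.
  under eq_fun do rewrite mxE.
  apply: (sa_mul (cmeasurable_algebra R mB)); last exact/cmeasurableS/cmeasurable_entry.
  split => /=; last exact: measurable_cst.
  (* On [B] the norm equals [maxdiag], and the inverse of this positive number is its real power
     with exponent -1, a measurable function. *)
  apply: (eq_measurable_fun (fun A : MT => maxdiag A `^ (-1))) => [A|].
    by rewrite inE => /BA AA; rewrite opnorm_Aset // powR_inv1 // ltW // maxdiag_gt0.
  apply: measurable_funTS.
  exact: (measurableT_comp (@measurable_powR R (-1)) maxdiag_measurable).
exists 1 => A /BA AA; rewrite nrmzE //; case: eqP => _; last by rewrite normr0.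
have m0 := maxdiag_gt0 AA; have [_ /(_ i)] := AA.
rewrite ltcE => /andP[_ /ltW Ai] _.
rewrite mulr1n ger0_norm ?ler0c ?mulr_ge0 ?invr_ge0 ?(ltW m0) //.
by rewrite (lecR _ 1) mulrC ler_pdivrMr // mul1r le_bigmax.
Qed.

End Integrability.

(** * The Haar twirl, the dilation twirl and their composition *)

Section Twirl.
Variables (R : realType) (d t : nat).
Local Notation C := R[i].
Local Notation MT := (MatT R d).
Local Notation tp := (@tpow R d t).

Definition Haar_twirl (muK : probability MT R) (X : 'M[C]_(dimH d t)) :=
  cint muK (fun K => tp K *m X *m (tp K) ^t*).

Variables (muK : probability MT R).
Hypothesis haar : is_haar muK.

Let twirl_entrywise Q X : star_algebra Q -> entrywise Q (fun K : MT => K : 'M[C]_d) ->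
  entrywise Q (fun K : MT => tp K *m X *m (tp K) ^t*).
Proof.
move=> QA QK; have QtK := entrywise_tpow (t := t) QA QK.
apply: (entrywise_mulmx QA); last exact: (entrywise_adj QA).
by apply: (entrywise_mulmx QA) => //; apply: (entrywise_cst QA).
Qed.

Lemma Haar_twirl_comm X U : @SUset R d U -> comm_mx (Haar_twirl muK X) (tp U).
Proof.
move=> SU; have [[B mB [BSU muB]] inv] := haar.
have UU : tp U *m (tp U) ^t* = 1%:M by rewrite -tpow_adj -tpowM SU.1 tpow1.
have UU' := mulmx1C UU.
have iB := cintegrable_algebra R mB.
have iK := twirl_entrywise X iB (SU_integrable BSU).
(* Linearity uses integrability on [B], while the change of variables uses measurability on the
   whole matrix space. *)
have mA := cmeasurable_algebra R (@measurableT _ MT).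
have eU : entrywise (cmeasurable setT) (fun K : MT => U *m K : 'M[C]_d).
  apply: (entrywise_mulmx mA); first exact: (entrywise_cst mA).
  exact: cmeasurable_entry.
have : cint muK (fun K : MT => tp (U *m K) *m X *m (tp (U *m K)) ^t*) =
    Haar_twirl muK X.
  apply: (cint_invariant (phi := fun K : MT => U *m K) eU).
    by move=> S mS; have [] := inv U SU S mS.
  exact: (twirl_entrywise X mA (@cmeasurable_entry R d)).
(* Averaging over U K instead of K conjugates G(X) by U^{(x)t}; the adjoint factor on the right then
   cancels against U^{(x)t}. *)
rewrite /comm_mx => {1}<-.
rewrite (_ : (fun K => _) = (fun K => tp U *m (tp K *m X *m (tp K) ^t*) *m (tp U) ^t*)).
  rewrite (cint_mulmxr mB muB) => [|i j]; last first.
    exact: (entrywise_mulmx iB (entrywise_cst iB _) iK).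
  by rewrite (cint_mulmxl mB muB) // -mulmxA UU' mulmx1.
by apply/funext => K; rewrite tpowM adjM !mulmxA.
Qed.

Variables (DL DV : YD d t -> nat)
  (vec : forall k, 'I_(DL k) -> 'I_(DV k) -> 'cV[C]_(dimH d t))
  (pi : forall k, 'M[C]_d -> 'M[C]_(DL k))
  (sigma : forall k, 'S_t -> 'M[C]_(DV k)).
Hypotheses (sb : is_schur_basis vec pi sigma) (d_gt0 : (0 < d)%N).

Lemma Haar_twirl_comm_GL X M : M \in unitmx -> comm_mx (Haar_twirl muK X) (tp M).
Proof. by apply: SU_comm_GL => // U; apply: Haar_twirl_comm. Qed.

Lemma Cint_cst (mu : probability MT R) a : Cint mu (fun=> a) = a.
Proof.
have E (r : R) : Rintegral mu setT (fun=> r) = r.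
  rewrite Rintegral_cst // -[RHS]mulr1; congr (_ * _).
  exact: (congr1 fine (probability_setT mu)).
by rewrite /Cint !E; case: a.
Qed.

(** [commutant_TU] leaves the coefficients Tr(G(X) P) with P a matrix unit of block k. As P commutes
    with K^{(x)t}, cyclicity of the trace makes the integrand constantly Tr(X P) on SU(d), so these
    are the coefficients of X itself. *)
Lemma Haar_twirl_TU X : Haar_twirl muK X = \sum_k TU vec k X.
Proof.
rewrite (commutant_TU sb (@Haar_twirl_comm_GL X)); apply: eq_bigr => k _.
congr (_ *: _); apply: eq_bigr => l1 _; apply: eq_bigr => l2 _; congr (_ *: _).
have [[B mB [BSU muB]] _] := haar.
have iA := cintegrable_algebra R mB.
have iK := twirl_entrywise X iA (SU_integrable BSU).
rewrite PiKL_adj -(cint_mulmxr mB muB) // (cint_trace mB muB); last first.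
  exact: (entrywise_mulmx iA iK (entrywise_cst iA _)).
rewrite -[RHS](Cint_cst muK); apply: (eq_Cint mB muB) => K /BSU SK.
rewrite -tpow_adj -!mulmxA mxtrace_mulC -!mulmxA -(tpow_PiKL sb) ?SU_unitmx //.
rewrite (mulmxA _ (tp K)) -tpowM.
by rewrite (mulmx1C SK.1) tpow1 mul1mx.
Qed.

Variables (nu : probability MT R).
Hypothesis nuA : concentrated nu (@Aset R d).

Definition dilation_twirl (X : 'M[C]_(dimH d t)) :=
  cint nu (fun A => tp (nrmz A) *m X *m (tp (nrmz A)) ^t*).

(** Each integral has constant outer factors, K A_n for the innermost and K for the middle one. They
    are pulled out one level at a time, so no integrals are exchanged. *)
Lemma TSL_twirl rho : TSL muK nu rho =
  Haar_twirl muK (dilation_twirl (Haar_twirl muK rho)).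
Proof.
have [[B mB [BSU muB]] _] := haar; have [BA mBA [BAA muBA]] := nuA.
have iB := cintegrable_algebra R mB; have iBA := cintegrable_algebra R mBA.
have iK := twirl_entrywise rho iB (SU_integrable BSU).
pose G := Haar_twirl muK rho.
have iN : entrywise (cintegrable BA)
    (fun A : MT => tp (nrmz A) *m G *m (tp (nrmz A)) ^t*).
  have iA := entrywise_tpow (t := t) iBA (nrmz_integrable d_gt0 mBA BAA).
  apply: (entrywise_mulmx iBA); last exact: (entrywise_adj iBA).
  by apply: (entrywise_mulmx iBA) => //; apply: (entrywise_cst iBA).
congr cint; apply/funext => K.
transitivity (cint nu (fun A => tp K *m (tp (nrmz A) *m G *m (tp (nrmz A)) ^t*) *m (tp K) ^t*)).
  congr cint; apply/funext => A.
  transitivity (cint muK (fun K' : MT => tp (K *m nrmz A) *m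
      (tp K' *m rho *m (tp K') ^t*) *m (tp (K *m nrmz A)) ^t*)).
    by congr cint; apply/funext => K'; rewrite /= tpow_adj tpowM adjM !mulmxA.
  rewrite (cint_mulmxr mB muB); last first.
    exact: (entrywise_mulmx iB (entrywise_cst iB _) iK).
  by rewrite (cint_mulmxl mB muB) // -/(Haar_twirl _ _) -/G tpowM adjM !mulmxA.
rewrite (cint_mulmxr mBA muBA); last first.
  exact: (entrywise_mulmx iBA (entrywise_cst iBA _) iN).
by rewrite (cint_mulmxl mBA muBA).
Qed.

Lemma dilation_trace X k l1 l2 :
  (forall M, M \in unitmx -> comm_mx X (tp M)) ->
  \tr (dilation_twirl X *m PiKL vec l1 l2) =
  \tr (cint nu (fun A => tp (nrmz A) *m tp (nrmz A)) *m X *m @PiKL R d t DL DV vec k l1 l2).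
Proof.
move=> XGL; have [B mB [BA muB]] := nuA; have iB := cintegrable_algebra R mB.
have iA := entrywise_tpow (t := t) iB (nrmz_integrable d_gt0 mB BA).
have icst n (M : 'M[C]_n) := entrywise_cst iB M.
have iN : entrywise (cintegrable B)
    (fun A : MT => tp (nrmz A) *m X *m (tp (nrmz A)) ^t*).
  apply: (entrywise_mulmx iB); last exact: (entrywise_adj iB).
  by apply: (entrywise_mulmx iB).
have iAA := entrywise_mulmx iB iA iA.
pose P := @PiKL R d t DL DV vec k l1 l2.
have iNP := entrywise_mulmx iB iN (icst _ P).
have iAAP := entrywise_mulmx iB iAA (icst _ (X *m P)).
rewrite /dilation_twirl -[X in X = _](congr1 mxtrace (cint_mulmxr mB muB P iN)).
rewrite -[in RHS]mulmxA -[RHS](congr1 mxtrace (cint_mulmxr mB muB (X *m P) iAA)).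
rewrite (cint_trace mB muB iNP) (cint_trace mB muB iAAP).
apply: (eq_Cint mB muB) => A /BA AA.
rewrite -tpow_adj nrmz_adj //; congr (\tr _).
by rewrite -!mulmxA (mulmxA X) XGL ?nrmz_unitmx // -!mulmxA.
Qed.

Lemma dilation_sqr_trace : exists b : YD d t -> C, forall k l l',
  \tr (cint nu (fun A => tp (nrmz A) *m tp (nrmz A)) *m @PiKL R d t DL DV vec k l l') =
  (l == l')%:R * b k.
Proof.
(* The witness is the averaged character of [pi k] at A_n^2. *)
exists (fun k => Cint nu (fun A => \tr (pi k (nrmz A *m nrmz A)))) => k l l'.
have [B mB [BA muB]] := nuA; have iB := cintegrable_algebra R mB.
have iA := entrywise_tpow (t := t) iB (nrmz_integrable d_gt0 mB BA).
have iAA := entrywise_mulmx iB iA iA.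
rewrite -(cint_mulmxr mB muB) // (cint_trace mB muB); last first.
  exact: (entrywise_mulmx iB iAA (entrywise_cst iB _)).
transitivity (Cint nu (fun A => (l == l')%:R * \tr (pi k (nrmz A *m nrmz A)))).
  apply: (eq_Cint mB muB) => A /BA AA.
  by rewrite -tpowM (tr_tpow_PiKL sb) // unitmx_mul nrmz_unitmx.
(* Splitting on l = l' moves the 0-1 factor out of the integral without any measurability claim
   about [pi k]. *)
case: eqP => _; last first.
  by under eq_fun do rewrite mul0r; rewrite mul0r Cint_cst.
by under eq_fun do rewrite mul1r; rewrite mul1r.
Qed.

(** The outer Haar twirl expands into the [TU k] of N(G(rho)), and [TU_filter] evaluates each of
    them because G(rho) is itself the sum of the [TU k' rho]. *)
Lemma TSL_TU rho : TSL muK nu rho =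
  \sum_k (beta nu vec k / (DL k * DV k)%N%:R) *: TU vec k rho.
Proof.
have [b bP] := dilation_sqr_trace.
rewrite TSL_twirl Haar_twirl_TU; apply: eq_bigr => k _.
apply: (TU_filter sb bP) => l l'.
by rewrite dilation_trace ?Haar_twirl_TU // => M; rewrite -Haar_twirl_TU; apply: Haar_twirl_comm_GL.
Qed.

End Twirl.

Theorem theorem1 (R : realType) (d t : nat) :
  (2 <= d)%N -> (1 <= t)%N ->
  forall (DL DV : YD d t -> nat)
    (vec : forall k, 'I_(DL k) -> 'I_(DV k) -> 'cV[R[i]]_(dimH d t))
    (pi : forall k, 'M[R[i]]_d -> 'M[R[i]]_(DL k))
    (sigma : forall k, 'S_t -> 'M[R[i]]_(DV k)),
  is_schur_basis vec pi sigma ->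
  forall (muK : probability (MatT R d) R), is_haar muK ->
  forall (nu : probability (MatT R d) R), concentrated nu (@Aset R d) ->
  forall rho : 'M[R[i]]_(dimH d t), density rho ->
  let D k := (DL k * DV k)%N in
  let c k := beta nu vec k / (D k)%:R in
  [/\ TSL muK nu rho = \sum_(k : YD d t) c k *: TU vec k rho,
      \tr (TSL muK nu rho)
        = \sum_(k : YD d t) c k * \tr (rho *m (PiK vec k) ^t*) &
      forall m : nat, (0 < m)%N ->
        iter m (TSL muK nu) rho = \sum_(k : YD d t) c k ^+ m *: TU vec k rho].
Proof.
move=> d2 _ DL DV vec pi sigma sb muK haar nu nuA rho _ D c.
have TSLE X := TSL_TU haar sb (ltnW d2) nuA X.
split; first exact: TSLE.
  rewrite TSLE raddf_sum; apply: eq_bigr => k _.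
  by rewrite /= mxtraceZ (tr_TU sb).
case=> // m _; elim: m => [|m IHm].
  by rewrite /= TSLE; apply: eq_bigr => k _; rewrite expr1.
(* In one more twirl [TU k] kills all terms with k' != k and fixes the remaining one, which gains
   another factor [c k]. *)
rewrite iterS IHm TSLE; apply: eq_bigr => k _.
rewrite linear_sum (bigD1 k) //= big1 => [|k' kk].
  by rewrite addr0 TUZ (TU_idem sb) eqxx scale1r scalerA -exprS.
by rewrite TUZ (TU_idem sb) eq_sym (negPf kk) scale0r scaler0.
Qed.
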